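(* The multiplicative semigroup $M_2(\mathbb{T})$ of all $2\times 2$ tropical matrices is a regular semigroup.
   Context: The tropical semiring is $\mathbb{T}=\mathbb{R}\cup\{-\infty\}$ with addition $a\oplus b=\max\{a,b\}$ and multiplication $a\odot b=a+b$ (with $-\infty$ absorbing for $\odot$). $M_2(\mathbb{T})$ is the set of $2\times 2$ matrices over $\mathbb{T}$ with matrix multiplication induced by $\oplus,\odot$. In a semigroup $(\mathcal{S},\cdot)$, an element $y$ is a generalized inverse of $x$ if $xyx=x$ and $yxy=y$. A semigroup is regular (in the von Neumann sense) if each of its elements has at least one generalized inverse. *)

(* Defs.v *)
From HB Require Import structures.
From mathcomp Require Import all_boot all_order all_algebra.
From mathcomp Require Import reals.

Set Implicit Arguments.
Unset Strict Implicit.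
Unset Printing Implicit Defensive.

Import Order.TTheory GRing.Theory Num.Theory.

Section SemigroupRegularity.
Local Open Scope group_scope.

Definition generalized_inverse (S : semigroupType) (x y : S) : Prop :=
  x * y * x = x /\ y * x * y = y.

Definition regular_semigroup (S : semigroupType) : Prop :=
  forall x : S, exists y : S, generalized_inverse x y.

End SemigroupRegularity.

(* An alias is needed since a semiring is not canonically a semigroupType. *)
Definition mult_semigroup (A : pzSemiRingType) : Type := A.

HB.instance Definition _ (A : pzSemiRingType) :=
  Choice.on (mult_semigroup A).
HB.instance Definition _ (A : pzSemiRingType) :=
  isSemigroup.Build (mult_semigroup A) (@mulrA A).

(* [None] stands for -oo, so it is the zero of the semiring; the one is
   [Some 0]. *)
Definition tropical (R : realType) : Type := option R.

Section TropicalSemiring.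
Local Open Scope ring_scope.
Variable R : realType.
Implicit Types a b c : tropical R.

Definition tropical_add a b : tropical R :=
  match a, b with
  | Some x, Some y => Some (Num.max x y)
  | Some _, None => a
  | None, _ => b
  end.

Definition tropical_mul a b : tropical R :=
  match a, b with
  | Some x, Some y => Some (x + y)
  | _, _ => None
  end.

Lemma tropical_addA : associative tropical_add.
Proof. by case=> [x|] [y|] [z|] //=; rewrite maxA. Qed.

Lemma tropical_addC : commutative tropical_add.
Proof. by case=> [x|] [y|] //=; rewrite maxC. Qed.

Lemma tropical_add0 : left_id None tropical_add.
Proof. by case. Qed.

Lemma tropical_mulA : associative tropical_mul.
Proof. by case=> [x|] [y|] [z|] //=; rewrite addrA. Qed.

Lemma tropical_mulC : commutative tropical_mul.
Proof. by case=> [x|] [y|] //=; rewrite addrC. Qed.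

Lemma tropical_mul1 : left_id (Some 0) tropical_mul.
Proof. by case=> [x|] //=; rewrite add0r. Qed.

Lemma tropical_mulDl : left_distributive tropical_mul tropical_add.
Proof. by case=> [x|] [y|] [z|] //=; rewrite addr_maxl. Qed.

Lemma tropical_mul0 : left_zero None tropical_mul.
Proof. by []. Qed.

Lemma tropical_one_neq0 : Some 0 != None :> option R.
Proof. by []. Qed.

HB.instance Definition _ := Choice.on (tropical R).
HB.instance Definition _ := GRing.isNmodule.Build (tropical R)
  tropical_addA tropical_addC tropical_add0.
HB.instance Definition _ := GRing.Nmodule_isComNzSemiRing.Build (tropical R)
  tropical_mulA tropical_mulC tropical_mul1 tropical_mulDl tropical_mul0
  tropical_one_neq0.

End TropicalSemiring.

(* Main.v *)
Require Import Defs.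
From mathcomp Require Import all_boot all_order all_algebra.
From mathcomp Require Import reals ring.

(** The theorem holds over every idempotent commutative semiring in which each
    nonzero element is invertible.  For X = [a b; c d] let p = ad + bc be its
    permanent and let X' = [d b; c a] be its adjugate with the signs dropped.
    Multiplying out, the (0, 0) entry of X X' X is aad + abc + abc + abc, and
    idempotency merges the repeated terms, leaving aad + abc = p a; the other
    entries behave in the same way, so that X X' X = p X.  As X'' = X and X' has the
    same permanent, X' X X' = p X' too.

    If p <> 0, the matrix p^-1 X' is therefore a generalized inverse of X.

    If p = 0, then ad = bc = 0, because a sum vanishes in an idempotent semiring
    only when both terms do.  Hence all the 2 x 2 products x_il x_kj and
    x_kl x_ij agree, i.e. X has rank at most one: either X = 0, which is its own
    generalized inverse, or X has a nonzero entry x_kl, and x_kl^-1 E_lk is a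
    generalized inverse of X. *)

Set Implicit Arguments.
Unset Strict Implicit.
Unset Printing Implicit Defensive.

Import GRing.Theory.
Local Open Scope ring_scope.

Section CommutativeSemiring.
Variable S : comNzSemiRingType.

(** With Y = v E_lk, the (i, j) entry of X Y X is v x_il x_kj, and the vanishing
    of the 2 x 2 minors through x_kl, written without subtraction, turns it into
    v x_kl x_ij = x_ij.  In Y X Y the only entry of X that matters is x_kl. *)
Lemma generalized_inverse_rank1 n (X : 'M[S]_n) (k l : 'I_n) (v : S) :
    v * X k l = 1 -> (forall i j, X i l * X k j = X k l * X i j) ->
  X *m (v *: delta_mx l k) *m X = X /\
  (v *: delta_mx l k) *m X *m (v *: delta_mx l k) = v *: delta_mx l k.
Proof.
move=> vX minors; split; apply/matrixP=> i j.
- rewrite !mxE (bigD1 k) //= !mxE (bigD1 l) //= !mxE !eqxx.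
  rewrite big1 => [|m /negPf ml]; last by rewrite !mxE ml mulr0 mulr0.
  rewrite big1 => [|m /negPf mk]; last first.
    by rewrite mxE big1 ?mul0r // => s _; rewrite !mxE mk andbF !mulr0.
  rewrite !addr0 mulr1 mulrAC minors mulrAC.
  by rewrite [X k l * v]mulrC vX mul1r.
- rewrite !mxE (bigD1 l) //= !mxE (bigD1 k) //= !mxE !eqxx.
  rewrite big1 => [|m /negPf mk]; last by rewrite !mxE mk andbF mulr0 mul0r.
  rewrite big1 => [|m /negPf ml]; last by rewrite !mxE ml !mulr0.
  rewrite !addr0 andbT /=.
  by case: (i == l); case: (j == k); rewrite /= ?mulr0 ?mul0r ?mulr1 ?vX ?mul1r.
Qed.

Definition per2 (X : 'M[S]_2) : S := X 0 0 * X 1 1 + X 0 1 * X 1 0.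

(** The adjugate without signs: [rev_ord] exchanges the two indices, so the
    (i, j) entry is the 1 x 1 minor left by deleting row j and column i. *)
Definition adj2 (X : 'M[S]_2) : 'M[S]_2 :=
  \matrix_(i, j) X (rev_ord j) (rev_ord i).

Lemma adj2K : involutive adj2.
Proof. by move=> X; apply/matrixP=> i j; rewrite !mxE !rev_ordK. Qed.

Lemma rev_ord2_0 : rev_ord (0 : 'I_2) = 1. Proof. exact: val_inj. Qed.
Lemma rev_ord2_1 : rev_ord (1 : 'I_2) = 0. Proof. exact: val_inj. Qed.

Lemma per2_adj2 X : per2 (adj2 X) = per2 X.
Proof.
rewrite /per2 !mxE rev_ord2_0 rev_ord2_1.
by rewrite [X 1 1 * _]mulrC.
Qed.

Lemma ord2P (i : 'I_2) : i = 0 \/ i = 1.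
Proof. by case: i => [[|[|//]] ?]; [left|right]; apply: val_inj. Qed.

Hypothesis addrr_idem : forall a : S, a + a = a.

Lemma idem_addr_eq0 (a b : S) : a + b = 0 -> a = 0 /\ b = 0.
Proof.
move=> ab0; split.
- by rewrite -[a]addr0 -ab0 addrA addrr_idem.
- by rewrite -[b]add0r -ab0 -addrA addrr_idem.
Qed.

(** The signless form of X (adj X) X = (det X) X: the two off-diagonal entries
    of X X' do not cancel, but the terms that they contribute to X X' X already
    occur in p X. *)
Lemma mulmx_adj2_mul (X : 'M[S]_2) : X *m adj2 X *m X = per2 X *: X.
Proof.
have sum2 (F : 'I_2 -> S) : \sum_i F i = F 0 + F 1.
  rewrite big_ord_recl big_ord1; congr (_ + F _); exact: val_inj.
apply/matrixP=> i j; rewrite !(mxE, sum2) /per2.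
rewrite rev_ord2_0 rev_ord2_1.
set a := X 0 0; set b := X 0 1; set c := X 1 0; set d := X 1 1.
(* Each entry of the left-hand side contains one monomial three times: abc, abd,
   acd, bcd in turn. *)
have idem3 (e : S) : e = e + e + e by rewrite !addrr_idem.
case: (ord2P i) => ->; case: (ord2P j) => ->; rewrite -/a -/b -/c -/d.
- by rewrite [in RHS](idem3 (b * c)); ring.
- by rewrite [in RHS](idem3 (a * d)); ring.
- by rewrite [in RHS](idem3 (a * d)); ring.
- by rewrite [in RHS](idem3 (b * c)); ring.
Qed.

Lemma generalized_inverse_adj2 (X : 'M[S]_2) (q : S) : q * per2 X = 1 ->
  X *m (q *: adj2 X) *m X = X /\
  (q *: adj2 X) *m X *m (q *: adj2 X) = q *: adj2 X.
Proof.
move=> qp; split.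
- by rewrite -scalemxAr -scalemxAl mulmx_adj2_mul scalerA qp scale1r.
- have := mulmx_adj2_mul (adj2 X); rewrite adj2K per2_adj2 => adjXadj.
  by rewrite -scalemxAr -!scalemxAl adjXadj !scalerA -mulrA qp mulr1.
Qed.

(** Off row k and column l the two products are the two terms of the
    permanent, hence both zero. *)
Lemma per2_eq0_minors (X : 'M[S]_2) (k l i j : 'I_2) :
  per2 X = 0 -> X i l * X k j = X k l * X i j.
Proof.
move=> /idem_addr_eq0[ad0 bc0].
have da0 := ad0; have cb0 := bc0; rewrite mulrC in da0; rewrite mulrC in cb0.
case: (ord2P k) => ->; case: (ord2P l) => ->;
  case: (ord2P i) => ->; case: (ord2P j) => -> //;
  by rewrite ?ad0 ?da0 ?bc0 ?cb0 // mulrC.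
Qed.

Hypothesis nonzero_inv : forall a : S, a != 0 -> exists b, b * a = 1.

Theorem regular_mx2_idempotent_semifield :
  regular_semigroup (mult_semigroup 'M[S]_2).
Proof.
move=> X; have [p0|/nonzero_inv[q qp]] := eqVneq (per2 X) 0; last first.
  by exists (q *: adj2 X); apply: generalized_inverse_adj2.
have [/existsP[k /existsP[l /nonzero_inv[v vX]]]|] :=
  boolP [exists k, exists l, (X : 'M[S]_2) k l != 0].
  exists (v *: delta_mx l k); apply: generalized_inverse_rank1 => // i j.
  exact: per2_eq0_minors.
move=> /existsPn X0; have -> : X = (0 : 'M[S]_2).
  apply/matrixP=> i j; rewrite mxE.
  by have /existsPn/(_ j)/negPn/eqP := X0 i.
by exists (0 : 'M[S]_2); split; apply: (etrans (mulmx0 _ _)).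
Qed.

End CommutativeSemiring.

Theorem corollary2p4 (R : realType) :
  regular_semigroup (mult_semigroup 'M[tropical R]_2).
Proof.
apply: regular_mx2_idempotent_semifield => [[x|]|[x|]] //.
- by congr Some; apply: Order.POrderTheory.maxxx.
- by move=> _; exists (Some (- x)); congr Some; rewrite addNr.
Qed.
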